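(* There exists a uniformly acyclic tree $T$ on $2\times 2$ such that, for each countable ordinal $\xi<\aleph_1$, there is a set $A_{1+\xi}\subseteq[T]$ which is ${\bf\Sigma}^0_{1+\xi}$ in $[T]$ but is not potentially ${\bf\Pi}^0_{1+\xi}$ (as a subset of $2^{\mathbb{N}}\times 2^{\mathbb{N}}$).
   Context: A Borel set $A\subseteq X\times Y$ ($X,Y$ Polish) is potentially in a class $\Gamma$ if there are finer Polish topologies $\sigma$ on $X$ and $\tau$ on $Y$ such that $A\in\Gamma([X,\sigma]\times[Y,\tau])$. A tree on $2\times 2$ is a set $T$ of pairs $(s,t)\in 2^{<\mathbb{N}}\times 2^{<\mathbb{N}}$ with $|s|=|t|$, closed under taking restrictions to a common shorter length; $[T]:=\{(\alpha,\beta):\forall n\ (\alpha|n,\beta|n)\in T\}$ with the subspace topology of $2^{\mathbb{N}}\times2^{\mathbb{N}}$. For a relation $R$ on a set $E$: an $R$-path is a finite sequence $(e_i)_{i\le n}$ with $(e_i,e_{i+1})\in R$ for $i<n$; an $R$-cycle is an $R$-path with $n\ge3$ such that for $0\le i\ne j\le n$, $e_i=e_j$ iff $\{i,j\}=\{0,n\}$; $R$ is acyclic if there is no $R$-cycle. $T$ is uniformly acyclic if for each $p>0$ the relation $T\cap(2^p\times2^p)$ on $2^p$ is irreflexive and antisymmetric and the symmetric relation it generates is acyclic. *)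

(* Defs.v *)
From HB Require Import structures.
From mathcomp Require Import all_boot all_order all_algebra.
From mathcomp Require Import all_classical all_reals all_analysis.

Set Implicit Arguments.
Unset Strict Implicit.
Unset Printing Implicit Defensive.

Import Order.TTheory GRing.Theory Num.Theory.

Local Open Scope classical_set_scope.
Local Open Scope ring_scope.

Section BorelHierarchy.
Context {d : Order.disp_t} {W : orderType d} {X : topologicalType}.

(* W is meant to be a well-order, and w : W stands for the ordinal xi which is
   the order type of the initial segment {v | v < w}. As eta |-> 1 + eta maps
   the ordinals < xi onto the ordinals in [1, 1 + xi), [sigma0 w] is the class
   Sigma^0_{1 + xi}: the open sets if xi = 0, and otherwise the countable unions
   of sets from the classes Pi^0_{1 + eta} with eta < xi. *)
Inductive sigma0 : W -> set X -> Prop :=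
| sigma0_open (w : W) (A : set X) :
    (forall v : W, ~ (v < w)%O) -> open A -> sigma0 w A
| sigma0_bigcup (w : W) (v : nat -> W) (F : nat -> set X) :
    (forall n, (v n < w)%O) -> (forall n, sigma0 (v n) (~` F n)) ->
    sigma0 w (\bigcup_n F n).

Definition pi0 (w : W) (A : set X) : Prop := sigma0 w (~` A).

End BorelHierarchy.

Definition is_metric (R : realType) (X : Type) (dist : X -> X -> R) : Prop :=
  [/\ forall x y, 0 <= dist x y,
      forall x y, dist x y = 0 <-> x = y,
      forall x y, dist x y = dist y x &
      forall x y z, dist x z <= dist x y + dist y z].

Definition compatible_metric (R : realType) (X : topologicalType)
    (dist : X -> X -> R) : Prop :=
  is_metric dist /\
  forall A : set X, open A <->
    forall x, A x -> exists2 e : R, 0 < e & [set y | dist x y < e] `<=` A.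

Definition complete_metric (R : realType) (X : topologicalType)
    (dist : X -> X -> R) : Prop :=
  forall u : nat -> X,
    (forall e : R, 0 < e -> exists N : nat, forall m n : nat,
       (N <= m)%N -> (N <= n)%N -> dist (u m) (u n) < e) ->
    exists l : X, u @ \oo --> l.

Definition separable (X : topologicalType) : Prop :=
  exists2 D : set X, countable D & dense D.

Definition polish (R : realType) (X : topologicalType) : Prop :=
  separable X /\
  exists2 dist : X -> X -> R, compatible_metric dist & complete_metric dist.

Record topology_on (X : choiceType) := TopologyOn {
  opens : set (set X);
  opens_setT : opens [set: X];
  opens_setI : setI_closed opens;
  opens_bigcup : forall S : set (set X),
    S `<=` opens -> opens (\bigcup_(A in S) A) }.

(* [retopologize sigma] is the space [X, sigma]: the same points as X, but with
   the topology sigma instead of the canonical one (if any). *)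
Definition retopologize (X : choiceType) (sigma : topology_on X) : Type := X.

Section Retopologize.
Context (X : choiceType) (sigma : topology_on X).

HB.instance Definition _ := Choice.on (retopologize sigma).

Let opens_bigU (I : Type) (f : I -> set X) :
  (forall i, opens sigma (f i)) -> opens sigma (\bigcup_i f i).
Proof.
move=> fo; have -> : \bigcup_i f i = \bigcup_(A in range f) A.
  by rewrite bigcup_image.
by apply: opens_bigcup => _ [i _ <-].
Qed.

HB.instance Definition _ := @isOpenTopological.Build (retopologize sigma)
  (opens sigma) (opens_setT sigma) (@opens_setI _ sigma) opens_bigU.

End Retopologize.

Definition finer (X : topologicalType) (sigma : topology_on X) : Prop :=
  [set A : set X | open A] `<=` opens sigma.

Definition potentially (R : realType)
    (Gamma : forall Z : topologicalType, set (set Z))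
    (X Y : topologicalType) (A : set (X * Y)) : Prop :=
  exists (sigma : topology_on X) (tau : topology_on Y),
    [/\ polish R (retopologize sigma) /\ finer sigma,
        polish R (retopologize tau) /\ finer tau &
        Gamma (retopologize sigma * retopologize tau)%type A].

Definition is_tree (T : set (seq bool * seq bool)) : Prop :=
  (forall s t, T (s, t) -> size s = size t) /\
  (forall s t n, T (s, t) -> (n <= size s)%N -> T (take n s, take n t)).

Definition body (T : set (seq bool * seq bool)) :
    set (cantor_space * cantor_space) :=
  [set ab | forall n : nat, T (mkseq ab.1 n, mkseq ab.2 n)].

Section Acyclicity.
Context {E : Type}.
Implicit Types (R : E -> E -> Prop) (n : nat) (e : nat -> E).

(* A finite sequence (e_i)_{i <= n} is given by a function on nat of which only
   the values at i <= n matter. *)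
Definition rel_path R n e : Prop :=
  forall i : nat, (i < n)%N -> R (e i) (e i.+1).

Definition rel_cycle R n e : Prop :=
  [/\ rel_path R n e, (3 <= n)%N &
      forall i j : nat, (i <= n)%N -> (j <= n)%N -> i <> j ->
        (e i = e j <-> (i = 0%N /\ j = n) \/ (i = n /\ j = 0%N))].

Definition rel_acyclic R : Prop := ~ exists n e, rel_cycle R n e.

Definition rel_sym R : E -> E -> Prop := fun x y => R x y \/ R y x.

End Acyclicity.

Definition level (T : set (seq bool * seq bool)) (p : nat) :
    p.-tuple bool -> p.-tuple bool -> Prop :=
  fun s t => T (tval s, tval t).

Definition uniformly_acyclic (T : set (seq bool * seq bool)) : Prop :=
  forall p : nat, (0 < p)%N ->
    [/\ forall s, ~ level T (p := p) s s,
        forall s t, level T (p := p) s t -> level T t s -> s = t &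
        rel_acyclic (rel_sym (level T (p := p)))].

(* Main.v *)
Require Import Defs.
From mathcomp Require Import all_boot all_order all_algebra.
From mathcomp Require Import all_classical all_reals all_analysis.
From mathcomp Require Import zify lra.

Set Implicit Arguments.
Unset Strict Implicit.
Unset Printing Implicit Defensive.

Import Order.TTheory GRing.Theory Num.Theory.

Local Open Scope classical_set_scope.

(** The tree is built level by level: every edge [(s, t)] of a level is continued
by [(s b, t b)], and one chosen edge (the center of the level) is moreover
continued by [(s 0, t 1)]. Thus each level consists of two copies of the previous
one joined by a single edge, hence is acyclic. The centers are dense in the tree,
even among the levels carrying a given label [(k, i)] with [k] in nat and [i] a
bit. A branch signals [(k, i)] if its two coordinates differ at a level with this
label, which is an open condition.

A finer Polish topology on Cantor space coincides with the usual one off a meager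
set. Given a meager set [M], density yields continuous [f, g] with values off [M]
such that [(f x, g x)] is a branch signalling exactly the bits of [x]. Starting
from a set [C] that is Sigma^0_xi but not Pi^0_xi in Cantor space, replacing the
condition "[x k = i]" by "signals [(k, i)]" in the construction of [C] gives a
Sigma^0_xi set [A] of branches whose preimage by [(f, g)] is [C], whatever [M] is;
so [A] is not potentially Pi^0_xi. *)

(** * The tree *)

(* Through [logn 2], every code occurs at arbitrarily large levels. *)
Definition code (p : nat) : option (seq bool * seq bool * (nat * bool)) :=
  unpickle (logn 2 p).

Definition label (p : nat) : option (nat * bool) := omap snd (code p).

(** Padding with zeros lets a short pair be the center of a long level. At level 0 both cases give
    the empty pair; at later levels the default has the wrong size and adds no edge. *)
Definition center (p : nat) : seq bool * seq bool :=
  if code p is Some (s, t, _) then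
    (take p (s ++ nseq p false), take p (t ++ nseq p false))
  else ([::], [::]).

Lemma code_unbounded x N : exists p, [/\ (N <= p)%N, (0 < p)%N & code p = Some x].
Proof.
(* The factor [3 ^ N] makes the level large without changing the 2-adic valuation, which alone
   determines the code. *)
exists (2 ^ pickle x * 3 ^ N)%N; split.
- by apply: leq_trans (leq_pmull _ _); rewrite ?expn_gt0// ltnW// ltn_expl.
- by rewrite muln_gt0 !expn_gt0.
- by rewrite /code lognM ?expn_gt0// pfactorK// lognX muln0 addn0 pickleK.
Qed.

(** The guard of [edge_diag] excludes the loops (b, b) at level 1, whose only edge is therefore (0,
    1). *)
Inductive edge : seq bool -> seq bool -> Prop :=
| edge_nil : edge [::] [::]
| edge_diag s t b : (0 < size s)%N -> edge s t -> edge (rcons s b) (rcons t b)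
| edge_new s t : edge s t -> (s, t) = center (size s) ->
    edge (rcons s false) (rcons t true).

Definition edge_tree : set (seq bool * seq bool) := [set e | edge e.1 e.2].

Lemma edge_size s t : edge s t -> size s = size t.
Proof. by elim=> {s t} [|s t b _ _ IH|s t _ IH _] //; rewrite !size_rcons IH. Qed.

Lemma edge_take s t n : edge s t -> edge (take n s) (take n t).
Proof.
elim=> {s t} [|s t b s0 st IH|s t st IH c]; first exact: edge_nil.
- have est := edge_size st.
  case: (ltnP (size s) n) => sn.
    rewrite !take_oversize ?size_rcons; [exact: edge_diag|lia..].
  by rewrite -!cats1 !takel_cat// -est.
- have est := edge_size st.
  case: (ltnP (size s) n) => sn.
    rewrite !take_oversize ?size_rcons; [exact: edge_new|lia..].
  by rewrite -!cats1 !takel_cat// -est.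
Qed.

Lemma edge_rcons_inv s t a b : edge (rcons s a) (rcons t b) ->
  (a = b /\ edge s t) \/ [/\ a = false, b = true & (s, t) = center (size s)].
Proof.
move: {-2}(rcons s a) {-2}(rcons t b) (erefl (rcons s a)) (erefl (rcons t b)).
move=> s' t' es et e; case: e es et => [|u v c _ uv|u v uv cuv].
- by case: s.
- by move=> /rcons_inj[<- <-] /rcons_inj[<- <-]; left.
- by move=> /rcons_inj[<- <-] /rcons_inj[<- <-]; right.
Qed.

(** Every longer edge extends the edge (0, 1) of level 1. The opposite first bits make each positive
    level irreflexive and antisymmetric. *)
Lemma edge_head s t : edge s t -> (0 < size s)%N ->
  ohead s = Some false /\ ohead t = Some true.
Proof.
elim=> {s t} [//|s t b s0 st IH _|s t st IH c _].
  by have := IH s0; have := edge_size st; case: s s0 {st IH} => // ? ? _; case: t.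
have := edge_size st; case: s IH {st c} => [|x s] IH; first by case: t IH.
by case: t IH => // y t /(_ isT).
Qed.

Lemma edge_tree_is_tree : is_tree edge_tree.
Proof.
split=> [s t /edge_size//|s t n st _]; exact: edge_take.
Qed.

Lemma constant_on_steps (T : Type) (b : nat -> T) m n : (m <= n)%N ->
  (forall k, (m <= k < n)%N -> b k = b k.+1) -> b m = b n.
Proof.
move=> /subnKC <-; elim: (n - m)%N => [|k IH] H; first by rewrite addn0.
rewrite IH ?addnS; first by apply: H; lia.
by move=> i ?; apply: H; lia.
Qed.

(* Removing the last bits maps a level to the previous one, except for the
   unique edge whose last bits differ; a cycle would cross it twice. *)
Lemma edge_acyclic p n (e : nat -> seq bool) :
  (forall i, (i <= n)%N -> size (e i) = p) -> ~ rel_cycle (rel_sym edge) n e.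
Proof.
elim: p e => [|p IH] e esz [epath n3 edist].
  have e0 i : (i <= n)%N -> e i = [::] by move/esz/size0nil.
  have [/(_ _)] := edist 0%N 1%N isT (ltac:(lia)) (ltac:(lia)).
  by rewrite !e0//; [case=> //; lia|lia].
pose b i := nth false (e i) p; pose r i := take p (e i).
have eE i : (i <= n)%N -> e i = rcons (r i) (b i).
  by move=> /esz si; rewrite /r /b -take_nth ?si// take_oversize ?si.
have rsz i : (i <= n)%N -> size (r i) = p.
  by move=> /esz si; rewrite /r size_takel// si.
have [bconst|] := pselect (forall i, (i < n)%N -> b i = b i.+1).
  have bE i : (i <= n)%N -> b i = b 0%N.
    move=> ni; apply/esym/constant_on_steps => // k ki; apply: bconst; lia.
  apply: (IH r rsz); split=> // [i ni|i j ni nj ij].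
    have := epath _ ni; rewrite /rel_sym !eE//; last exact: ltnW.
    rewrite bconst//.
    by move=> [/edge_rcons_inv|/edge_rcons_inv] [[_ ?]|[-> //]]; [left|right].
  rewrite -(edist i j ni nj ij) (eE i)// (eE j)//; split=> [->|].
    by rewrite !bE.
  by move/rcons_inj => [].
move=> /existsNP[i /not_implyP[ni bi]].
(* If the last bit changed only once, [b 0] and [b n] would differ, whereas a cycle closes up with
   [e 0 = e n]. *)
have [j [nj ij bj]] : exists j, [/\ (j < n)%N, i <> j & b j <> b j.+1].
  apply: contrapT => nex.
  have step k : (k < n)%N -> k <> i -> b k = b k.+1.
    by move=> kn ki; apply: contrapT => bk; apply: nex; exists k; split=> // ik; apply: ki.
  have b0i : b 0%N = b i by apply: constant_on_steps => // k ?; apply: step; lia.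
  have bin : b i.+1 = b n by apply: constant_on_steps => // k ?; apply: step; lia.
  apply: bi; rewrite -b0i bin /b; congr (nth _ _ _).
  by apply/(edist 0%N n) => //; [lia|left].
have flip k : (k < n)%N -> b k <> b k.+1 ->
    let: (s, t) := center p in
    (e k = rcons s false /\ e k.+1 = rcons t true) \/
    (e k = rcons t true /\ e k.+1 = rcons s false).
  move=> nk bk; have := epath _ nk; rewrite /rel_sym !eE//; last exact: ltnW.
  move=> [] /edge_rcons_inv; rewrite rsz// ?(ltnW nk)//.
    by move=> [[]//|[-> -> <-]]; left.
  by move=> [[/esym//]|[-> -> <-]]; right.
case: (center p) flip => s t flip.
(* Both crossings use the same edge, in equal or opposite directions. As a cycle repeats a vertex
   only at its ends, this would force [n <= 2]. *)
have [] : (e i = e j) \/ (e i = e j.+1 /\ e i.+1 = e j).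
  case: (flip i ni bi) => [] [-> ->]; case: (flip j nj bj) => [] [-> ->]; tauto.
  by move=> /(edist i j (ltnW ni) (ltnW nj) ij); lia.
move=> [e1 e2].
have H1 : i = j.+1 \/ (i = 0%N /\ j.+1 = n).
  have [|ne] := pselect (i = j.+1); first by left.
  by move/(edist i j.+1 (ltnW ni) nj ne): e1; lia.
have H2 : i.+1 = j \/ (i.+1 = n /\ j = 0%N).
  have [|ne] := pselect (i.+1 = j); first by left.
  by move/(edist i.+1 j ni (ltnW nj) ne): e2; lia.
lia.
Qed.

Lemma edge_tree_uniformly_acyclic : uniformly_acyclic edge_tree.
Proof.
move=> p p0; split=> [s /edge_head|s t /edge_head st /edge_head ts|].
- by rewrite size_tuple => /(_ p0)[->].
- by move: st ts; rewrite !size_tuple => /(_ p0)[-> _] /(_ p0)[_].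
- move=> [n [e [epath n3 edist]]].
  apply: (@edge_acyclic p n (fun i => tval (e i))); first by move=> i _; rewrite size_tuple.
  split=> // i j ni nj ij; rewrite -(edist i j ni nj ij).
  by split=> [/val_inj|->].
Qed.

(* Any edge extends diagonally into prescribed dense sets and then to the
   center of a level carrying a prescribed label. *)
Lemma edge_extend (D : seq bool -> Prop) s t (l : nat * bool) :
  (forall u, exists w, D (u ++ w)) -> edge s t -> (0 < size s)%N ->
  exists w, [/\ edge (rcons (s ++ w) false) (rcons (t ++ w) true),
    (exists m, D (take m (s ++ w))), (exists m, D (take m (t ++ w))) &
    label (size (s ++ w)) = Some l].
Proof.
move=> Dd st s0.
have diag w : edge (s ++ w) (t ++ w).
  elim/last_ind: w => [|w b IH]; first by rewrite !cats0.
  by rewrite -!rcons_cat; apply: edge_diag => //; rewrite size_cat ltn_addr.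
(* Appending [w2], chosen for the second word, does no harm to the first: only some prefix has to
   lie in [D]. *)
have [w1 Dw1] := Dd s; have [w2 Dw2] := Dd (t ++ w1).
pose s' := s ++ w1 ++ w2; pose t' := t ++ w1 ++ w2.
have st' : size s' = size t' by exact/edge_size/diag.
(* At a level [p] coded by this very edge, its padding by zeros is the center, so the bits 0 and 1
   may be appended. *)
have [p [sp p0 cp]] := code_unbounded (s', t', l) (size s').
pose w := w1 ++ w2 ++ nseq (p - size s') false.
have sE : s ++ w = s' ++ nseq (p - size s') false by rewrite /w /s' !catA.
have tE : t ++ w = t' ++ nseq (p - size s') false by rewrite /w /t' !catA.
have szp : size (s ++ w) = p by rewrite sE size_cat size_nseq subnKC.
exists w; split.
- apply: edge_new => //; rewrite szp /center cp sE tE.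
  rewrite !take_cat -!st' ltnNge sp/= !take_nseq ?leq_subr//.
- by exists (size (s ++ w1)); rewrite /w catA take_size_cat.
- exists (size ((t ++ w1) ++ w2)).
  have -> : t ++ w = ((t ++ w1) ++ w2) ++ nseq (p - size s') false.
    by rewrite /w !catA.
  by rewrite take_size_cat.
- by rewrite szp /label cp.
Qed.

(** * Branches off a meager set *)

(* [D n] stands for the open set of the [x] having a prefix in [D n]. *)
Definition meager (M : set cantor_space) : Prop :=
  exists2 D : nat -> seq bool -> Prop,
    forall n s, exists w, D n (s ++ w) &
    forall x : cantor_space, (forall n, exists m, D n (mkseq x m)) -> ~ M x.

(** Level 0 is left out because the coordinates of every branch of the tree differ there. *)
Definition signals (k : nat) (i : bool) : set (cantor_space * cantor_space) :=
  [set ab | exists p, [/\ (0 < p)%N, label p = Some (k, i) & ab.1 p <> ab.2 p]].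

Lemma mkseq_eqP (x y : nat -> bool) n :
  mkseq x n = mkseq y n <-> forall i, (i < n)%N -> x i = y i.
Proof.
split=> [exy i ni|exy]; last first.
  by apply/eq_in_map => i; rewrite mem_iota => /andP[_ ?]; apply: exy.
by have := congr1 (fun s => nth false s i) exy; rewrite !nth_mkseq.
Qed.

Lemma take_mkseq (x : nat -> bool) m n : (m <= n)%N ->
  take m (mkseq x n) = mkseq x m.
Proof. by move=> mn; rewrite /mkseq -map_take take_iota (minn_idPl mn). Qed.

(* A Cantor scheme of edges: the [k]-th step meets the [k]-th dense set and then
   uses the new edge of a level labelled with the [k]-th bit. *)
Lemma section_off_meager (M : set cantor_space) : meager M ->
  exists f g : cantor_space -> cantor_space,
  [/\ forall n x y, mkseq x n = mkseq y n -> mkseq (f x) n = mkseq (f y) n,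
      forall n x y, mkseq x n = mkseq y n -> mkseq (g x) n = mkseq (g y) n,
      forall x, body edge_tree (f x, g x),
      forall x, ~ M (f x) /\ ~ M (g x) &
      forall x k i, signals k i (f x, g x) <-> x k = i].
Proof.
move=> [D Dd DM].
have /choice[W WP] : forall el : (seq bool * seq bool) * (nat * bool), exists w,
    edge el.1.1 el.1.2 -> (0 < size el.1.1)%N ->
    [/\ edge (rcons (el.1.1 ++ w) false) (rcons (el.1.2 ++ w) true),
    (exists m, D el.2.1 (take m (el.1.1 ++ w))),
    (exists m, D el.2.1 (take m (el.1.2 ++ w))) &
    label (size (el.1.1 ++ w)) = Some el.2].
  move=> [[s t] l] /=.
  have [[st s0]|nst] := pselect (edge s t /\ (0 < size s)%N).
    by have [w Hw] := @edge_extend (D l.1) s t l (Dd l.1) st s0; exists w.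
  by exists [::] => st s0; case: nst.
(* The first entry of the label [(k, x k)] also selects the dense set [D k]. *)
pose step (x : nat -> bool) k (e : seq bool * seq bool) :=
  let w := W (e, (k, x k)) in (rcons (e.1 ++ w) false, rcons (e.2 ++ w) true).
pose E x k := iteri k (step x) ([:: false], [:: true]).
have E_edge x k : edge (E x k).1 (E x k).2 /\ (k < size (E x k).1)%N.
  elim: k => [|k [IH1 IH2]] /=.
    by split=> //; exact: (edge_new edge_nil).
  have [] := WP (E x k, (k, x k)) IH1 (leq_ltn_trans (leq0n k) IH2).
  by move=> ? _ _ _; split; rewrite //= size_rcons size_cat ltnS ltn_addr.
have E_step x k : E x k.+1 = step x k (E x k) by [].
have E_pre x k k' : (k <= k')%N ->
    prefix (E x k).1 (E x k').1 /\ prefix (E x k).2 (E x k').2.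
  move=> /subnKC <-; elim: (k' - k)%N => [|j [IH1 IH2]].
    by rewrite addn0 !prefix_refl.
  rewrite addnS E_step /step /= -!cats1 -!catA.
  by split; [apply: (prefix_trans IH1)|apply: (prefix_trans IH2)]; exact: prefix_prefix.
have E_size x k : size (E x k).2 = size (E x k).1.
  by have [/edge_size] := E_edge x k.
(* The words of [E x m] have more than [m] letters and depend only on the first [m] bits of [x];
   this makes [f] and [g] continuous. *)
pose f (x : cantor_space) : cantor_space := fun m => nth false (E x m).1 m.
pose g (x : cantor_space) : cantor_space := fun m => nth false (E x m).2 m.
have nth_pre (u v : seq bool) m : prefix u v -> (m < size u)%N ->
    nth false u m = nth false v m.
  by move=> /prefixP[w ->] mu; rewrite nth_cat mu.
have fE x k m : (m < size (E x k).1)%N -> f x m = nth false (E x k).1 m.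
  move=> mk; have [_ mm] := E_edge x m; rewrite /f.
  have [km|/ltnW mk'] := leqP k m.
    by have [/nth_pre->] := E_pre x _ _ km.
  by have [/nth_pre->] := E_pre x _ _ mk'.
have gE x k m : (m < size (E x k).1)%N -> g x m = nth false (E x k).2 m.
  move=> mk; have [_ mm] := E_edge x m; rewrite /g.
  have [km|/ltnW mk'] := leqP k m.
    by have [_ /nth_pre->] := E_pre x _ _ km; rewrite ?E_size.
  by have [_ /nth_pre->] := E_pre x _ _ mk'; rewrite ?E_size.
have fseq x k n : (n <= size (E x k).1)%N -> mkseq (f x) n = take n (E x k).1.
  move=> nk; rewrite -[in RHS](mkseq_nth false (E x k).1) take_mkseq//.
  by apply/mkseq_eqP => i ni; apply: fE; exact: leq_trans nk.
have gseq x k n : (n <= size (E x k).1)%N -> mkseq (g x) n = take n (E x k).2.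
  move=> nk; rewrite -[in RHS](mkseq_nth false (E x k).2) take_mkseq ?E_size//.
  by apply/mkseq_eqP => i ni; apply: gE; exact: leq_trans nk.
have E_local n x y : mkseq x n = mkseq y n -> E x n = E y n.
  move=> /mkseq_eqP; elim: n => // n IH exy.
  by rewrite !E_step IH /step ?exy// => i ni; apply: exy; exact: ltnW.
have E_localW n m (x y : cantor_space) : mkseq x n = mkseq y n -> (m < n)%N -> E x m = E y m.
  move=> /mkseq_eqP exy mn; apply/E_local/mkseq_eqP => i im.
  by apply: exy; exact: ltn_trans mn.
have EW x k := WP (E x k, (k, x k)) (E_edge x k).1 (leq_ltn_trans (leq0n k) (E_edge x k).2).
(* Apart from position 0, the two words differ only where a new edge was used, so nothing but the
   true bits of [x] is signalled. *)
have E_diff x k p : (0 < p < size (E x k).1)%N ->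
    nth false (E x k).1 p <> nth false (E x k).2 p ->
    exists j, label p = Some (j, x j).
  elim: k => [|k IH]; first by rewrite /=; lia.
  rewrite E_step /= size_rcons; have [_ _ _ /= lab] := EW x k.
  move=> /andP[p0 pk]; rewrite -!cats1 !nth_cat !size_cat E_size.
  have [psk|psk] := ltnP p (size (E x k).1).
    by rewrite ltn_addr// => /IH; apply; rewrite p0.
  have [//|psw _] := ltnP p.
  exists k; rewrite -lab; congr label.
  by apply/eqP; rewrite eqn_leq size_cat psw -size_cat andbT.
exists f, g; split.
- by move=> n x y exy; apply/mkseq_eqP => i ni; rewrite /f (E_localW _ _ _ _ exy).
- by move=> n x y exy; apply/mkseq_eqP => i ni; rewrite /g (E_localW _ _ _ _ exy).
- move=> x n; have [xn nsz] := E_edge x n.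
  by rewrite /= (fseq x n) 1?(gseq x n) 1?ltnW//; exact: edge_take.
- move=> x; split; apply: DM => k; have [_ [m Dm] [m' Dm'] _] := EW x k.
    exists (minn m (size ((E x k).1 ++ W (E x k, (k, x k))))).
    rewrite (fseq x k.+1) E_step /= ?size_rcons ?leqW ?geq_minr//.
    rewrite -cats1 takel_cat ?geq_minr//.
    have [mm|mm] := leqP m (size ((E x k).1 ++ W (E x k, (k, x k)))) => //.
    by rewrite take_size; rewrite take_oversize// in Dm; exact: ltnW.
  exists (minn m' (size ((E x k).2 ++ W (E x k, (k, x k))))).
  rewrite (gseq x k.+1) E_step /= ?size_rcons ?leqW//; last first.
    by rewrite !size_cat E_size geq_minr.
  rewrite -cats1 takel_cat ?geq_minr//.
  have [mm|mm] := leqP m' (size ((E x k).2 ++ W (E x k, (k, x k)))) => //.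
  by rewrite take_size; rewrite take_oversize// in Dm'; exact: ltnW.
- move=> x k i; split=> [[p [p0 lp]]|xki].
    have [_ psz] := E_edge x p.
    rewrite /= (fE x p)// (gE x p)// => /E_diff; rewrite p0 => /(_ psz)[j].
    by rewrite lp => -[-> ->].
  exists (size ((E x k).1 ++ W (E x k, (k, x k)))).
  have [_ _ _ lab] := EW x k; have [_ sz] := E_edge x k; split.
  + by rewrite size_cat ltn_addr//; exact: leq_ltn_trans sz.
  + by rewrite lab xki.
  + rewrite /= (fE x k.+1) ?(gE x k.+1) E_step /= ?size_rcons//.
    by rewrite !nth_rcons !size_cat E_size ltnn eqxx.
Qed.

(** * Meager sets and finer Polish topologies *)

Definition cylinder (s : seq bool) : set cantor_space :=
  [set x | mkseq x (size s) = s].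

Lemma cylinder_self (x : cantor_space) n : cylinder (mkseq x n) x.
Proof. by rewrite /cylinder /= size_mkseq. Qed.

Lemma cylinder_catP (x : cantor_space) s n : cylinder s x -> (size s <= n)%N ->
  exists w, mkseq x n = s ++ w.
Proof.
move=> xs sn; exists (drop (size s) (mkseq x n)).
by rewrite -[in X in X ++ _]xs -(take_mkseq x sn) cat_take_drop.
Qed.

Lemma cylinder_mkseq (x y : cantor_space) n :
  cylinder (mkseq x n) y <-> mkseq y n = mkseq x n.
Proof. by rewrite /cylinder /= size_mkseq. Qed.

Lemma sub_meager (M N : set cantor_space) : M `<=` N -> meager N -> meager M.
Proof. by move=> MN [D Dd DN]; exists D => // x /DN Nx /MN. Qed.

Lemma meager_bigcup (I : countType) (M : I -> set cantor_space) :
  (forall i, meager (M i)) -> meager (\bigcup_i M i).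
Proof.
move=> mM.
have /choice[D DP] : forall i, exists D : nat -> seq bool -> Prop,
    (forall n s, exists w, D n (s ++ w)) /\
    forall x : cantor_space, (forall n, exists m, D n (mkseq x m)) -> ~ M i x.
  by move=> i; have [D ? ?] := mM i; exists D.
exists (fun n s => if unpickle n is Some (i, k) then D i k s else True).
  move=> n s; case: (unpickle n) => [[i k]|]; last by exists [::].
  exact: (DP i).1.
move=> x Dx [i _]; apply: (DP i).2 => k.
by have [m] := Dx (pickle (i, k)); rewrite pickleK => ?; exists m.
Qed.

Lemma meager0 : meager set0.
Proof. by exists (fun _ _ => True) => [n s|x _ []]; exists [::]. Qed.

Lemma meagerU (M N : set cantor_space) : meager M -> meager N -> meager (M `|` N).
Proof.
move=> mM mN.
apply: (@sub_meager _ (\bigcup_b (fun b : bool => if b then M else N) b)).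
  by move=> x [Mx|Nx]; [exists true|exists false].
by apply: meager_bigcup => -[].
Qed.

Lemma nowhere_dense_meager (D : seq bool -> Prop) :
  (forall s, exists w, D (s ++ w)) -> meager [set x | forall m, ~ D (mkseq x m)].
Proof.
by move=> Dd; exists (fun=> D) => // x /(_ 0%N)[m Dm] /(_ m).
Qed.

Definition heavy (V : set cantor_space) (s : seq bool) : Prop :=
  forall w, ~ meager (V `&` cylinder (s ++ w)).

(* The largest open set in which [V] is everywhere non-meager. *)
Definition heavy_part (V : set cantor_space) : set cantor_space :=
  [set x | exists n, heavy V (mkseq x n)].

Lemma heavy_cat V s w : heavy V s -> heavy V (s ++ w).
Proof. by move=> Vs w'; rewrite -catA. Qed.

Lemma heavy_partP V x n : heavy_part V x -> exists2 m, (n <= m)%N & heavy V (mkseq x m).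
Proof.
move=> [k Vk]; exists (maxn n k); first exact: leq_maxl.
have [||w ->] := @cylinder_catP x (mkseq x k) (maxn n k).
- exact: cylinder_self.
- by rewrite size_mkseq leq_maxr.
- exact: heavy_cat.
Qed.

(** A point of [V] outside the heavy part either lies in one of the countably many cylinders where
    [V] is meager, or has no prefix in [D]. The latter points are nowhere dense, since a word that
    is not heavy extends to one on whose cylinder [V] is meager. *)
Lemma meager_diff_heavy_part V : meager (V `\` heavy_part V).
Proof.
pose D s := meager (V `&` cylinder s) \/ heavy V s.
apply: (@sub_meager _ ((\bigcup_s [set x | V x /\ cylinder s x /\ meager (V `&` cylinder s)])
  `|` [set x | forall m, ~ D (mkseq x m)])).
  move=> x [Vx nx]; have [|/existsNP[m /contrapT[Dm|Dm]]] := pselect (forall m, ~ D (mkseq x m)).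
  - by right.
  - left; exists (mkseq x m) => //.
    by do 2!split=> //; exact: cylinder_self.
  - by case: nx; exists m.
apply: meagerU.
  apply: meager_bigcup => s; have [m|nm] := pselect (meager (V `&` cylinder s)).
    by apply: sub_meager m => x [Vx [sx _]].
  by apply: sub_meager meager0 => x [_ [_ /nm]].
apply: nowhere_dense_meager => s.
have [hs|/existsNP[w /contrapT mw]] := pselect (heavy V s).
  by exists [::]; rewrite cats0; right.
by exists w; left.
Qed.

Lemma heavy_bigcup (V : nat -> set cantor_space) s :
  heavy (\bigcup_i V i) s -> exists i w, heavy (V i) (s ++ w).
Proof.
move=> hs; apply: contrapT => nex; apply: (hs [::]); rewrite cats0.
apply: (@sub_meager _ (\bigcup_i (V i `\` heavy_part (V i)))).
  move=> x [[i _ Vx] sx]; exists i => //; split=> // /(heavy_partP (size s)) [n sn hn].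
  by apply: nex; have [w ew] := cylinder_catP sx sn; exists i, w; rewrite -ew.
by apply: meager_bigcup => i; exact: meager_diff_heavy_part.
Qed.

(** Every word extends to one where some [V i] is heavy, or below which the union is nowhere heavy.
    A point of the difference has no prefix of either kind. *)
Lemma meager_heavy_bigcup (V : nat -> set cantor_space) :
  meager (heavy_part (\bigcup_i V i) `\` \bigcup_i heavy_part (V i)).
Proof.
pose D s := (exists i, heavy (V i) s) \/ (forall w, ~ heavy (\bigcup_i V i) (s ++ w)).
apply: (@sub_meager _ [set x | forall m, ~ D (mkseq x m)]).
  move=> x [hx nx] m [[i hi]|nh]; first by apply: nx; exists i => //; exists m.
  have [n mn] := heavy_partP m hx.
  have [||w ->] := @cylinder_catP x (mkseq x m) n; rewrite ?size_mkseq//.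
    exact: cylinder_self.
  exact: nh.
apply: nowhere_dense_meager => s.
have [[w hw]|nh] := pselect (exists w, heavy (\bigcup_i V i) (s ++ w)).
  have [i [w' h']] := heavy_bigcup hw.
  by exists (w ++ w'); left; exists i; rewrite catA.
by exists [::]; rewrite cats0; right => w hw; apply: nh; exists w.
Qed.

Lemma heavy_nonempty V x n : heavy_part V x ->
  exists2 y, V y & mkseq y n = mkseq x n.
Proof.
move=> /(heavy_partP n)[m nm hm]; apply: contrapT => nex; apply: (hm [::]).
rewrite cats0; apply: sub_meager meager0 => y [Vy /cylinder_mkseq yx].
apply: nex; exists y => //.
by rewrite -(take_mkseq y nm) -(take_mkseq x nm) yx.
Qed.

Lemma cylinder_nbhs (x : cantor_space) n : nbhs x (cylinder (mkseq x n)).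
Proof.
elim: n => [|n IH]; first by apply: filterS filterT => y _; apply/cylinder_mkseq.
have xn : nbhs x (@proj nat (fun=> bool) n @^-1` [set x n]).
  by apply: (@proj_continuous _ (fun=> bool) n x); exact: discrete_set1.
apply: filterS (filterI IH xn) => y [/cylinder_mkseq/mkseq_eqP yx yn].
apply/cylinder_mkseq/mkseq_eqP => i.
by rewrite ltnS leq_eqVlt => /predU1P[->|/yx].
Qed.

Lemma cantor_openP (A : set cantor_space) : open A <->
  forall x, A x -> exists n, cylinder (mkseq x n) `<=` A.
Proof.
split=> [oA x Ax|Acyl]; last first.
  rewrite openE => x /Acyl[n nA]; exact: filterS nA (cylinder_nbhs x n).
(* The filter generated by the cylinders around [x] converges to [x], because each coordinate is
   constant on a long enough cylinder. *)
pose F : set_system cantor_space := [set B | exists n, cylinder (mkseq x n) `<=` B].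
have FF : Filter F.
  split=> [|B C [n nB] [m mC]|B C BC [n nB]].
  - by exists 0%N.
  - exists (maxn n m) => y /cylinder_mkseq yx; split; [apply: nB|apply: mC].
    + by apply/cylinder_mkseq; rewrite -(take_mkseq y (leq_maxl n m)) yx take_mkseq// leq_maxl.
    + by apply/cylinder_mkseq; rewrite -(take_mkseq y (leq_maxr n m)) yx take_mkseq// leq_maxr.
  - by exists n; exact: subset_trans BC.
have Fx : F --> x.
  apply/cvg_sup => i B [C [[U oU <-] Ux UB]].
  exists i.+1 => y /cylinder_mkseq/mkseq_eqP yx; apply: UB => /=.
  by rewrite yx.
by apply: Fx; exact: open_nbhs_nbhs.
Qed.

Lemma cylinder_open s : open (cylinder s).
Proof.
apply/cantor_openP => x xs; exists (size s) => y /cylinder_mkseq.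
by rewrite /cylinder /= => ->.
Qed.

Section PolishRefinement.
Local Open Scope ring_scope.

(* Off a meager set, "heavy in [V]" implies "in the sigma-closure of [V]"
   whenever [V] is a finite intersection of balls: heaviness is passed on to
   smaller and smaller balls, whose points converge for both topologies. *)
Lemma finer_polish_agree (R : realType) (sigma : topology_on cantor_space) :
  polish R (retopologize sigma) -> finer sigma ->
  exists2 M : set cantor_space, meager M &
  forall (O : set cantor_space) x, opens sigma O -> O x -> ~ M x ->
    exists n, forall y, mkseq y n = mkseq x n -> ~ M y -> O y.
Proof.
move=> [[Q cQ dQ] [dist [[_ dist0 distC distD] dist_open] dist_complete]] fin.
pose X : topologicalType := retopologize sigma.
have ball_open (x : X) (e : R) : open [set y : X | dist x y < e].
  apply/dist_open => y /= xy; exists (e - dist x y); first by rewrite subr_gt0.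
  move=> z /= yz; apply: le_lt_trans (distD x y z) _.
  by rewrite -ltrBrDl.
pose r j : R := j.+1%:R^-1.
have r_gt0 j : 0 < r j by rewrite invr_gt0.
have r_small e : 0 < e -> exists j, r j < e.
  by move=> /ltr_add_invr[k]; rewrite add0r; exists k.
have r_le i j : (i <= j)%N -> r j <= r i.
  by move=> ij; rewrite lef_pV2 ?posrE ?ltr0n// ler_nat.
have [d dP] : exists d : nat -> X, forall x e, 0 < e -> exists i, dist (d i) x < e.
  have [q [_ Qq]] := dQ setT (ex_intro _ (point : cantor_space) I) openT.
  have /countable_injP[h hinj] := cQ.
  have /choice[d dP] : forall i, exists z : X, forall y, Q y -> h y = i -> z = y.
    move=> i; have [[y Qy hy]|ny] := pselect (exists2 y, Q y & h y = i).
      by exists y => z Qz hz; apply: hinj; rewrite ?inE// hy.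
    by exists q => y Qy hy; case: ny; exists y.
  exists d => x e e0.
  have [z [/= xz Qz]] : [set y | dist x y < e] `&` Q !=set0.
    apply: dQ (ball_open x e); exists x => /=.
    by have /dist0-> : x = x by [].
  by exists (h z); rewrite (dP _ _ Qz erefl) distC.
(* Balls of radii 1, 1/2, 1/3, ... about points of the dense sequence [d]; by density each [V l] is
   the union of its successors. *)
pose V (l : seq nat) : set cantor_space :=
  [set x | forall j, (j < size l)%N -> dist (d (nth 0%N l j)) x < r j].
have V_rcons l i x : V (rcons l i) x <-> V l x /\ dist (d i) x < r (size l).
  rewrite /V /= size_rcons; split=> [H|[H1 H2] j].
    split=> [j jl|]; last by have := H _ (ltnSn _); rewrite nth_rcons ltnn eqxx.
    by have := H j (ltnW jl); rewrite nth_rcons jl.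
  rewrite ltnS nth_rcons leq_eqVlt => /predU1P[->|jl]; first by rewrite ltnn eqxx.
  by rewrite jl; exact: H1.
have V_cover l : V l = \bigcup_i V (rcons l i).
  apply/seteqP; split=> [x Vx|x [i _ /V_rcons[]]//].
  by have [i di] := dP x _ (r_gt0 (size l)); exists i => //; apply/V_rcons.
pose M : set cantor_space := (\bigcup_l (V l `\` heavy_part (V l))) `|`
  (\bigcup_l (heavy_part (V l) `\` \bigcup_i heavy_part (V (rcons l i)))).
exists M.
  apply: meagerU; apply: meager_bigcup => l; first exact: meager_diff_heavy_part.
  rewrite [in X in X `\` _]V_cover; exact: meager_heavy_bigcup.
have M_heavy l x : ~ M x -> V l x -> heavy_part (V l) x.
  by move=> nM Vx; apply: contrapT => nh; apply: nM; left; exists l.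
have M_next l x : ~ M x -> heavy_part (V l) x ->
    exists i, heavy_part (V (rcons l i)) x.
  move=> nM hx; apply: contrapT => nh; apply: nM; right; exists l => //.
  by split=> // -[i _ hi]; apply: nh; exists i.
have heavy_closure l j y : ~ M y -> (j < size l)%N -> heavy_part (V l) y ->
    dist (d (nth 0%N l j)) y <= r j.
  move=> nM jl hy.
  have /choice[N NP] : forall l', exists i,
      heavy_part (V l') y -> heavy_part (V (rcons l' i)) y.
    move=> l'; have [/(M_next _ _ nM)[i hi]|] := pselect (heavy_part (V l') y).
      by exists i.
    by exists 0%N.
  pose L k := iter k (fun l' => rcons l' (N l')) l.
  have Lh k : heavy_part (V (L k)) y by elim: k => //= k /NP.
  have Lsz k : size (L k) = (size l + k)%N.
    by elim: k => [|k IH] /=; rewrite ?addn0// size_rcons IH addnS.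
  have Lnth k k' i : (k <= k')%N -> (i < size (L k))%N ->
      nth 0%N (L k') i = nth 0%N (L k) i.
    move=> /subnKC <-; elim: (k' - k)%N => [|m IH] ik; first by rewrite addn0.
    rewrite addnS /= nth_rcons Lsz addnA -Lsz ltn_addr//; exact: IH.
  (* The shrinking balls make [z] Cauchy for [dist], while the agreement on [k] bits makes it
     converge to [y] in the usual topology. *)
  have /choice[z zP] : forall k, exists z, V (L k) z /\ mkseq z k = mkseq y k.
    by move=> k; have [z Vz zy] := heavy_nonempty k (Lh k); exists z.
  have z_close i k : (i < size (L i.+1))%N -> (i < k)%N ->
      dist (d (nth 0%N (L i.+1) i)) (z k) < r i.
    by move=> iL ik; rewrite -(Lnth _ _ _ ik iL); apply: (zP k).1; rewrite Lsz; lia.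
  have [c zc] : exists c : X, (z : nat -> X) @ \oo --> c.
    apply: dist_complete => e e0.
    have [i ri] := r_small (e / 2) (divr_gt0 e0 (ltr0n _ 2)).
    have iL : (i < size (L i.+1))%N by rewrite Lsz; lia.
    exists i.+1 => m n im jn.
    apply: le_lt_trans (distD _ (d (nth 0%N (L i.+1) i)) _) _; rewrite distC.
    by have := z_close _ _ iL im; have := z_close _ _ iL jn; lra.
  (* As [sigma] is finer, the limit for [dist] is also a limit for the usual topology. *)
  have cy : c = y.
    apply/funext => i.
    have : nbhs c (cylinder (mkseq c i.+1)).
      apply: open_nbhs_nbhs; split; last exact: cylinder_self.
      by apply: fin; exact: cylinder_open.
    move=> /zc[n _ /(_ (maxn n i.+1) (leq_maxl _ _))] /cylinder_mkseq/mkseq_eqP <-//.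
    by have [_ /mkseq_eqP->] := zP (maxn n i.+1); rewrite // leq_max ltnSn orbT.
  rewrite leNgt; apply/negP => yr.
  have : nbhs c [set u : X | dist y u < dist (d (nth 0%N l j)) y - r j].
    apply: open_nbhs_nbhs; split; first exact: ball_open.
    by rewrite /= cy; have /dist0-> : (y : X) = y by []; rewrite subr_gt0.
  move=> /zc[n _ /(_ n (leqnn _))] /=.
  have : dist (d (nth 0%N l j)) (z n) < r j.
    by rewrite -(Lnth 0%N n j)//; apply: (zP n).1; rewrite Lsz; lia.
  by have := distD (d (nth 0%N l j)) (z n) y; rewrite (distC y); lra.
move=> O x oO Ox nMx.
have [e e0 eO] := (dist_open O).1 oO x Ox.
(* Radius below [e / 2]: the distance from [x] to [y] is estimated through a common center. *)
have [j rj] := r_small (e / 2) (divr_gt0 e0 (ltr0n _ 2)).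
have [l [lsz Vl]] : exists l, size l = j.+1 /\ V l x.
  elim: j.+1 => [|k [l [lsz Vl]]]; first by exists [::].
  rewrite V_cover in Vl; have [i _ Vi] := Vl.
  by exists (rcons l i); rewrite size_rcons lsz.
have [n hn] := M_heavy _ _ nMx Vl; exists n => y yx nMy.
have hy : heavy_part (V l) y by exists n; rewrite yx.
apply: eO => /=.
have jl : (j < size l)%N by rewrite lsz.
have := heavy_closure _ _ _ nMy jl hy; have := Vl _ jl.
by have := distD x (d (nth 0%N l j)) y; rewrite (distC x (d _)); lra.
Qed.

End PolishRefinement.

(** * Universal sets and transfer to the branches *)

Section Hierarchy.
Context {d : Order.disp_t} {W : orderType d}.
Implicit Types (w : W).

Lemma sigma0_preimage (X Y : topologicalType) (h : X -> Y) w (A : set Y) :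
  (forall O, open O -> open (h @^-1` O)) -> sigma0 w A -> sigma0 w (h @^-1` A).
Proof.
move=> ho; elim=> {w A} [w A wmin oA|w v F vw _ IH].
  by apply: sigma0_open => //; exact: ho.
rewrite preimage_bigcup; apply: sigma0_bigcup vw _ => n.
exact: IH.
Qed.

(* Open sets [P k i] that detect the bits of a point of Cantor space need only
   do so on a subset: complements may be taken in the whole space [X]. *)
Lemma sigma0_lift (X : topologicalType) (P : nat -> bool -> set X) w
    (C : set cantor_space) :
  (forall k i, open (P k i)) -> sigma0 w C ->
  exists2 C' : set X, sigma0 w C' &
    forall x (c : cantor_space), (forall k i, P k i x <-> c k = i) -> C' x <-> C c.
Proof.
move=> Po; elim=> {w C} [w C wmin oC|w v F vw _ IH].
  (* [Q s] is the substitute for [cylinder s]: a finite conjunction of bit conditions, hence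
     open. *)
  pose Q s : set X := [set x | forall k, (k < size s)%N -> P k (nth false s k) x].
  have Qo s : open (Q s).
    elim/last_ind: s => [|s b IH].
      by rewrite (_ : Q [::] = setT); [exact: openT|apply/seteqP; split].
    rewrite (_ : Q (rcons s b) = Q s `&` P (size s) b); first exact: openI.
    apply/seteqP; split=> x; rewrite /Q /= size_rcons.
      move=> H; split=> [k ks|]; last by have := H _ (ltnSn _); rewrite nth_rcons ltnn eqxx.
      by have := H k (ltnW ks); rewrite nth_rcons ks.
    move=> [H1 H2] k; rewrite ltnS nth_rcons leq_eqVlt => /predU1P[->|ks].
      by rewrite ltnn eqxx.
    by rewrite ks; exact: H1.
  exists (\bigcup_(s in [set s | cylinder s `<=` C]) Q s).
    by apply: sigma0_open => //; exact: bigcup_open.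
  move=> x c xc; split=> [[s sC Qx]|Cc].
    apply: sC; rewrite /cylinder /=.
    rewrite -[RHS](mkseq_nth false); apply/mkseq_eqP => k ks.
    by apply/xc; exact: Qx.
  have [n nC] := (cantor_openP C).1 oC c Cc; exists (mkseq c n) => // k.
  by rewrite size_mkseq => kn; apply/xc; rewrite nth_mkseq.
have /choice[G GP] : forall n, exists G : set X, sigma0 (v n) G /\
    forall x (c : cantor_space), (forall k i, P k i x <-> c k = i) -> G x <-> ~ F n c.
  by move=> n; have [G sG GP] := IH n; exists G; split=> // x c /GP.
exists (\bigcup_n ~` G n).
  by apply: sigma0_bigcup vw _ => n; rewrite setCK; exact: (GP n).1.
move=> x c xc; split=> -[n _ H]; exists n => //.
  by apply: contrapT => nF; apply: H; apply/((GP n).2 x c xc).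
by move=> /((GP n).2 x c xc).
Qed.

(** Provides the trivial sets that fill idle rows in the universal set. The two claims are proved
    together, as each at [w] uses the other below [w]. *)
Lemma sigma0_setT_set0 (X : topologicalType) w :
  well_founded (fun v w : W => (v < w)%O) ->
  sigma0 w [set: X] /\ sigma0 w (set0 : set X).
Proof.
move=> Wwf; elim: (Wwf w) => {}w _ IH.
have [[v vw]|nv] := pselect (exists v, (v < w)%O).
  split.
    rewrite (_ : setT = \bigcup_(_ in [set: nat]) setT); last first.
      by rewrite bigcup_const//; exists 0%N.
    by apply: (@sigma0_bigcup _ _ _ w (fun=> v)) => // n; rewrite setCT; exact: (IH v vw).2.
  rewrite (_ : set0 = \bigcup_(_ in [set: nat]) set0); last by rewrite bigcup0.
  by apply: (@sigma0_bigcup _ _ _ w (fun=> v)) => // n; rewrite setC0; exact: (IH v vw).1.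
have wmin v : ~ (v < w)%O by move=> vw; apply: nv; exists v.
by split; apply: sigma0_open => //; [exact: openT|exact: open0].
Qed.

Definition cantor_row (m : nat) (x : cantor_space) : cantor_space :=
  fun k => x (pickle (m, k)).

Lemma cantor_row_surj (c : nat -> cantor_space) :
  exists x, forall m, cantor_row m x = c m.
Proof.
exists (fun i => if unpickle i is Some (m, k) then c m k else false) => m.
by apply/funext => k; rewrite /cantor_row pickleK.
Qed.

Lemma cantor_row_open m (O : set cantor_space) : open O -> open (cantor_row m @^-1` O).
Proof.
move=> /cantor_openP oO; apply/cantor_openP => x /oO[n nO].
exists (\max_(k < n) (pickle (m, val k)).+1)%N => y /cylinder_mkseq/mkseq_eqP yx.
apply: nO; apply/cylinder_mkseq/mkseq_eqP => k kn; apply: yx.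
exact: (@leq_bigmax _ (fun k : 'I_n => (pickle (m, val k)).+1) (Ordinal kn)).
Qed.

(** Each ordinal below [w] occurs with every index [n], so one fixed sequence of classes
    accommodates all sequences of sets used in forming unions at [w]. *)
Lemma below_enum w : countable [set: W] -> (exists v, (v < w)%O) ->
  exists2 v : nat -> W, forall m, (v m < w)%O &
    exists idx : nat -> nat, forall u n, (u < w)%O -> exists m, v m = u /\ idx m = n.
Proof.
move=> /countable_injP[h hinj] [v0 v0w].
have /choice[v vP] : forall m : nat, exists u, (u < w)%O /\
    forall u' (n : nat), (u' < w)%O -> m = pickle (h u', n) -> u = u'.
  move=> m; have [[u [n [uw mE]]]|nu] :=
      pselect (exists u (n : nat), (u < w)%O /\ m = pickle (h u, n)).
    exists u; split=> // u' n' _; rewrite mE => /(pcan_inj pickleK)[huu _].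
    by apply: hinj; rewrite ?inE.
  by exists v0; split=> // u' n' uw' mE; case: nu; exists u', n'.
exists v; first by move=> m; exact: (vP m).1.
exists (fun m => if (unpickle m : option (nat * nat)) is Some (_, n) then n else 0%N).
move=> u n uw; exists (pickle (h u, n)); rewrite pickleK; split=> //.
exact: (vP _).2 uw erefl.
Qed.

(** Being Sigma^0 in the product is expressed through continuous substitutions [h1], [h2]: the
    recursion substitutes rows of the parameter, the diagonal argument the identity. *)
Lemma sigma0_universal w :
  well_founded (fun v w : W => (v < w)%O) -> countable [set: W] ->
  exists U : cantor_space -> set cantor_space,
  (forall h1 h2 : cantor_space -> cantor_space,
     (forall O, open O -> open (h1 @^-1` O)) ->
     (forall O, open O -> open (h2 @^-1` O)) ->
     sigma0 w [set x | U (h1 x) (h2 x)]) /\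
  (forall C : set cantor_space, sigma0 w C -> exists c, U c = C).
Proof.
move=> Wwf Wcount; elim: (Wwf w) => {}w _ IH.
have [wnmin|nv] := pselect (exists v, (v < w)%O); last first.
  have wmin v : ~ (v < w)%O by move=> vw; apply: nv; exists v.
  pose U (c : cantor_space) : set cantor_space :=
    \bigcup_(s in [set s | c (pickle s)]) cylinder s.
  exists U; split=> [h1 h2 h1o h2o|C sC]; last first.
    case: sC wmin => {w nv IH C} [w C _ oC|w v F vw _] wmin; last first.
      by have := wmin _ (vw 0%N).
    pose q (i : nat) :=
      if unpickle i is Some s then `[< cylinder s `<=` C >] else false.
    have qE s : q (pickle s) = `[< cylinder s `<=` C >] by rewrite /q pickleK.
    exists q; apply/seteqP; split=> [x [s]|x Cx].
      by rewrite /mkset qE => /asboolP; exact.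
    have [n nC] := (cantor_openP C).1 oC x Cx; exists (mkseq x n).
      by rewrite /mkset qE; exact/asboolP.
    exact: cylinder_self.
  apply: sigma0_open => //.
  rewrite (_ : [set x | _] = \bigcup_s ((h1 @^-1` [set c | c (pickle s)]) `&`
      (h2 @^-1` cylinder s))); last first.
    by apply/seteqP; split=> [x [s ? ?]|x [s _ [? ?]]]; exists s.
  apply: bigcup_open => s _; apply: openI; last exact/h2o/cylinder_open.
  apply: h1o; apply/cantor_openP => x xs; exists (pickle s).+1.
  by move=> y /cylinder_mkseq/mkseq_eqP /(_ _ (ltnSn _)) /= ->.
have [v vw [idx vidx]] := below_enum Wcount wnmin.
have /choice[U UP] : forall u, exists U : cantor_space -> set cantor_space,
    (u < w)%O ->
  (forall h1 h2 : cantor_space -> cantor_space,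
     (forall O, open O -> open (h1 @^-1` O)) ->
     (forall O, open O -> open (h2 @^-1` O)) ->
     sigma0 u [set x | U (h1 x) (h2 x)]) /\
  (forall C : set cantor_space, sigma0 u C -> exists c, U c = C).
  move=> u; have [/IH[U HU]|nuw] := boolP (u < w)%O; first by exists U.
  by exists (fun=> set0).
exists (fun c => \bigcup_m ~` U (v m) (cantor_row m c)); split.
  move=> h1 h2 h1o h2o.
  rewrite (_ : [set x | _] =
    \bigcup_m ~` [set x | U (v m) (cantor_row m (h1 x)) (h2 x)]); last first.
    by apply/seteqP; split=> x [m ? ?]; exists m.
  apply: (sigma0_bigcup vw) => m; rewrite setCK.
  apply: ((UP _ (vw m)).1 (cantor_row m \o h1) h2) => // O oO.
  exact: (h1o _ (cantor_row_open m oO)).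
move=> C sC; case: sC UP vw vidx wnmin => {w IH C} [w C wmin _ _ _ _ [z /wmin]//|w u F uw sF UP vw vidx _].
(* Row [m] codes [F (idx m)] when the class [v m] is the right one, and otherwise contributes the
   empty set to the union. *)
have /choice[c cP] : forall m, exists c,
    ~` U (v m) c = if v m == u (idx m) then F (idx m) else set0.
  move=> m; case: eqP => [vu|_].
    have [c cF] := (UP _ (vw m)).2 (~` F (idx m)) (ltac:(by rewrite vu; exact: sF)).
    by exists c; rewrite cF setCK.
  have [c cT] := (UP _ (vw m)).2 setT (sigma0_setT_set0 _ _ Wwf).1.
  by exists c; rewrite cT setCT.
have [x xc] := cantor_row_surj c; exists x.
apply/seteqP; split=> [y [m _]|y [n _ Fy]].
  by rewrite xc cP; case: ifP => // _ Fy; exists (idx m).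
have [m [vm im]] := vidx _ n (uw n).
by exists m => //; rewrite xc cP im vm eqxx.
Qed.

(** Cantor's diagonal: were the complement of the diagonal a section [U c], then [c] would lie in
    [U c] exactly when it does not. *)
Lemma sigma0_not_pi0 w :
  well_founded (fun v w : W => (v < w)%O) -> countable [set: W] ->
  exists2 C : set cantor_space, sigma0 w C & ~ pi0 w C.
Proof.
move=> Wwf Wcount; have [U [Us Uu]] := sigma0_universal w Wwf Wcount.
exists [set x | U x x]; first exact: (Us id id).
move=> /Uu[c cE].
have : U c c <-> ~ U c c by rewrite {1}cE.
tauto.
Qed.

End Hierarchy.

Lemma signals_open k i : open (signals k i).
Proof.
have bit_open p b : open [set x : cantor_space | x p = b].
  apply/cantor_openP => x xp; exists p.+1.
  by move=> y /cylinder_mkseq/mkseq_eqP /(_ _ (ltnSn _)) /= ->.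
rewrite (_ : signals k i =
  \bigcup_(pb in [set pb : nat * bool | (0 < pb.1)%N /\ label pb.1 = Some (k, i)])
    (fst @^-1` [set x : cantor_space | x pb.1 = pb.2] `&`
     snd @^-1` [set x : cantor_space | x pb.1 = ~~ pb.2])); last first.
  apply/seteqP; split=> [[x y] [p [p0 lp /= xy]]|[x y] [[p b] [p0 lp] /= [xp yp]]].
    by exists (p, x p) => //; split=> //=; move: xy; case: (x p); case: (y p).
  by exists p; split=> //=; rewrite xp yp /=; case: (b).
apply: bigcup_open => -[p b] _; apply: openI.
  by apply: open_comp => // z _; exact: cvg_fst.
by apply: open_comp => // z _; exact: cvg_snd.
Qed.

Lemma prod_preimage_open (X Y Z : topologicalType) (f : X -> Y) (g : X -> Z) :
  (forall O, open O -> open (f @^-1` O)) -> (forall O, open O -> open (g @^-1` O)) ->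
  forall O : set (Y * Z), open O -> open ((fun x => (f x, g x)) @^-1` O).
Proof.
move=> /continuousP fc /continuousP gc; apply/continuousP => x.
by apply: cvg_pair; [exact: fc|exact: gc].
Qed.

Theorem theorem14 (R : realType) :
  exists T : set (seq bool * seq bool),
    [/\ is_tree T,
        uniformly_acyclic T &
        forall (d : Order.disp_t) (W : orderType d),
          countable [set: W] ->
          well_founded (fun v w : W => (v < w)%O) ->
          forall xi : W,
            exists A : set (cantor_space * cantor_space),
              [/\ A `<=` body T,
                  sigma0 xi [set x : set_type (body T) | A (set_val x)] &
                  ~ potentially R (fun Z => pi0 (X := Z) xi) A]].
Proof.
exists edge_tree; split.
- exact: edge_tree_is_tree.
- exact: edge_tree_uniformly_acyclic.
move=> d W Wcount Wwf xi.
have [C sC nC] := sigma0_not_pi0 xi Wwf Wcount.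
pose P k i : set (set_type (body edge_tree)) := set_val @^-1` signals k i.
have Po k i : open (P k i).
  by exists (signals k i) => //; exact: signals_open.
have [C' sC' C'P] := sigma0_lift Po sC.
pose A : set (cantor_space * cantor_space) := set_val @` C'.
have AE (x : set_type (body edge_tree)) : A (set_val x) <-> C' x.
  by split=> [[y Cy /val_inj <-]|Cx]//; exists x.
exists A; split.
- by move=> _ [x _ <-]; exact: set_valP.
- by rewrite (_ : [set x | _] = C')//; apply/seteqP; split=> x /AE.
move=> [sigma [tau [[spol sfin] [tpol tfin] Api]]].
have [M mM MP] := finer_polish_agree spol sfin.
have [N mN NP] := finer_polish_agree tpol tfin.
have [f [g [floc gloc fgT fgM fgS]]] := section_off_meager (meagerU mM mN).
(* The values of [f] avoid [M], off which [sigma]-open sets are relatively open in the usual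
   topology; so [f] remains continuous into the finer space. *)
have fo (O : set (retopologize sigma)) : open O ->
    open ((f : cantor_space -> retopologize sigma) @^-1` O).
  move=> oO; apply/cantor_openP => x Ox.
  have [n nO] := MP _ _ oO Ox (fun h => (fgM x).1 (or_introl h)).
  exists n => y /cylinder_mkseq yx; apply: nO; first exact: floc.
  by move=> My; apply: (fgM y).1; left.
have go (O : set (retopologize tau)) : open O ->
    open ((g : cantor_space -> retopologize tau) @^-1` O).
  move=> oO; apply/cantor_openP => x Ox.
  have [n nO] := NP _ _ oO Ox (fun h => (fgM x).2 (or_intror h)).
  exists n => y /cylinder_mkseq yx; apply: nO; first exact: gloc.
  by move=> My; apply: (fgM y).2; right.
apply: nC; rewrite /pi0.
have := sigma0_preimage (prod_preimage_open fo go) Api.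
(* Pulling back [A] by [(f, g)] must return [C]; it does because the branch [(f x, g x)] signals
   exactly the bits of [x]. *)
suff AC x : A (f x, g x) <-> C x.
  by congr (sigma0 _ _); apply/seteqP; split=> x nx /AC.
rewrite -(C'P (exist _ (f x, g x) (mem_set (fgT x))) x (fgS x)).
exact: (AE (exist _ (f x, g x) (mem_set (fgT x)))).
Qed.
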